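(* If $\overline{\beta} > 0$, then every point $(x,u,y,z,t) \in T$ satisfies $$(\overline{\gamma}-\underline{\gamma})y + \underline{\gamma} (\overline{\gamma} x - u) + \overline{\beta} (u - \underline{\gamma} x) \leq \overline{\beta}(t - \underline{\gamma}).$$
   Context: Let $\underline{\gamma} \le \overline{\gamma}$ and $\underline{\beta} \le \overline{\beta}$ be real parameters. The set $T \subseteq \mathbb{R}^5$ consists of all $(x,u,y,z,t)$ satisfying $$u = x t,\quad y + u \le 0,\quad z + x \le 1,\quad y \le \overline{\beta} z,\quad y \ge \underline{\beta} z,\quad z \ge 0,\quad x \in [0,1],\quad t \in [\underline{\gamma}, \overline{\gamma}].$$ *)

(* Defs.v *)
From mathcomp Require Import all_boot all_order all_algebra.
From mathcomp Require Import classical_sets reals.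

Set Implicit Arguments.
Unset Strict Implicit.
Unset Printing Implicit Defensive.

Import Order.TTheory GRing.Theory Num.Theory.

Local Open Scope classical_set_scope.
Local Open Scope ring_scope.

(* Points of R^5 are left-nested tuples in the order (x, u, y, z, t);
   gmin, gmax, bmin, bmax are the lower and upper bounds gamma and beta. *)
Definition T_set (R : realType) (gmin gmax bmin bmax : R) :
    set (R * R * R * R * R) :=
  [set p | let: (x, u, y, z, t) := p in
    [/\ u = x * t,
        y + u <= 0,
        z + x <= 1,
        y <= bmax * z &
        y >= bmin * z]
    /\ [/\ z >= 0,
        0 <= x <= 1 &
        gmin <= t <= gmax]].

(* Main.v *)
Require Import Defs.
From mathcomp Require Import all_boot all_order all_algebra.
From mathcomp Require Import classical_sets reals.
From mathcomp Require Import lra.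

(** Write g, G for the bounds on t and B for the upper bound on the slope y / z.
    Since u = x t, the claim is (G - g) y + g x (G - t) <= B (1 - x) (t - g).
    Splitting G - g = (G - t) + (t - g) turns it into a combination, with the
    nonnegative weights t - g and G - t, of the two upper bounds on y:
    y <= B z <= B (1 - x) and y <= - u = - x t <= - x g. *)

Set Implicit Arguments.
Unset Strict Implicit.
Unset Printing Implicit Defensive.

Import Order.TTheory GRing.Theory Num.Theory.

Local Open Scope classical_set_scope.
Local Open Scope ring_scope.

Theorem theorem3p5 (R : realType) (gmin gmax bmin bmax : R)
    (hg : gmin <= gmax) (hb : bmin <= bmax) (hbmax : 0 < bmax)
    (x u y z t : R) (hT : T_set gmin gmax bmin bmax (x, u, y, z, t)) :
  (gmax - gmin) * y + gmin * (gmax * x - u) + bmax * (u - gmin * x)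
    <= bmax * (t - gmin).
Proof.
case: hT => -[-> yu zx yz _] [_ /andP[x0 _] /andP[gt tG]].
have y_slope : y <= bmax * (1 - x).
  by apply: (le_trans yz); rewrite ler_pM2l //; lra.
have y_bilin : y + gmin * x <= 0.
  have : x * gmin <= x * t by rewrite ler_wpM2l.
  lra.
have w_slope : (t - gmin) * y <= (t - gmin) * (bmax * (1 - x)).
  by rewrite ler_wpM2l // subr_ge0.
have w_bilin : (gmax - t) * (y + gmin * x) <= 0.
  by rewrite mulr_ge0_le0 // subr_ge0.
lra.
Qed.
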